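(* For all complex numbers $A, B, C, D \in \mathbb{C}$: if $A \leq B$ and $C \leq D$, then $A + C \leq B + D$.
   Context: The relation $\leq$ on $\mathbb{C}$ is defined as follows. Write $A = a_1 + a_2 i$, $B = b_1 + b_2 i$ with $a_1,a_2,b_1,b_2 \in \mathbb{R}$. Then $A \leq B$ means: $a_1 < b_1$, or ($a_1 = b_1$ and $a_2 \leq b_2$). *)

(* Defs.v *)
From Stdlib Require Import Reals.
From Coquelicot Require Import Coquelicot.

(* The lexicographic order on complex numbers, real part first. *)
Definition Cle (z w : C) : Prop :=
  (Re z < Re w)%R \/ (Re z = Re w /\ (Im z <= Im w)%R).

Declare Scope Cle_scope.
Notation "z <= w" := (Cle z%C w%C) (at level 70, no associativity) : Cle_scope.

(* Main.v *)
Require Import Defs.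
From Stdlib Require Import Reals Lra.
From Coquelicot Require Import Coquelicot.
Local Open Scope Cle_scope.

(** Addition acts coordinatewise.  If the real part increases strictly in one of
    the two given inequalities, it does so in the sum, which decides the
    lexicographic comparison; otherwise both real parts agree and the imaginary
    inequalities add up. *)

Theorem theorem3 (A B C D : Complex.C) :
  A <= B -> C <= D -> A + C <= B + D.
Proof.
  unfold Cle, Re, Im; simpl.
  intros [HAB | [HAB1 HAB2]] [HCD | [HCD1 HCD2]].
  - left; lra.
  - left; lra.
  - left; lra.
  - right; split; lra.
Qed.
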